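(* Let $1<\alpha<2$, $a<b$, and $f:[a,b]\times\mathbb{R}\to\mathbb{R}$. Let $\underline{\sigma},\overline{\sigma}$ be a lower and an upper solution, respectively, of problem (P): $$T^a_\alpha u(t)+f(t,u(t))=0\ \ (a<t<b),\qquad u(a)=u(b)=0,$$ with $\underline{\sigma}(t)\le\overline{\sigma}(t)$ for all $t\in[a,b]$. Let $E=\{(t,x)\in[a,b]\times\mathbb{R}:\underline{\sigma}(t)\le x\le\overline{\sigma}(t)\}$ and assume $f$ is continuous on $E$. Then (P) has at least one solution $u\in AC^2[a,b]$, twice differentiable on $(a,b)$, such that $\underline{\sigma}(t)\le u(t)\le\overline{\sigma}(t)$ for all $t\in[a,b]$.
   Context: Conformable derivative: for $0<\beta<1$ and a function $h:[a,\infty)\to\mathbb{R}$, $T^a_\beta h(t)=\lim_{\varepsilon\to0}\frac{h(t+\varepsilon(t-a)^{1-\beta})-h(t)}{\varepsilon}$ for $t>a$, whenever the limit exists. For $1<\alpha<2$ and $g$ with derivative $g'$, $T^a_\alpha g(t)=T^a_{\alpha-1}g'(t)$; for $t>a$ this exists iff $g'$ is differentiable at $t$, and then $T^a_\alpha g(t)=(t-a)^{2-\alpha}g''(t)$. $AC^2[a,b]=\{u\in C^1[a,b]: u'\text{ absolutely continuous on }[a,b]\}$. A lower solution of (P) is $\underline{\sigma}\in AC^2[a,b]$, twice differentiable on $(a,b)$, with $T^a_\alpha\underline{\sigma}(t)+f(t,\underline{\sigma}(t))\ge0$ for all $t\in(a,b)$ and $\underline{\sigma}(a)\le0$, $\underline{\sigma}(b)\le0$.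 An upper solution of (P) is $\overline{\sigma}\in AC^2[a,b]$, twice differentiable on $(a,b)$, with $T^a_\alpha\overline{\sigma}(t)+f(t,\overline{\sigma}(t))\le0$ for all $t\in(a,b)$ and $\overline{\sigma}(a)\ge0$, $\overline{\sigma}(b)\ge0$. A solution of (P) satisfies the equation at every $t\in(a,b)$ and the boundary conditions. *)

(* Defs.v *)
From Stdlib Require Import Reals Lra List.
Open Scope R_scope.

Definition deriv_on (u u' : R -> R) (a b : R) : Prop :=
  forall t, a <= t <= b ->
    limit1_in (fun x => (u x - u t) / (x - t)) (fun x => a <= x <= b /\ x <> t) (u' t) t.

Definition cont_on (g : R -> R) (a b : R) : Prop :=
  forall t, a <= t <= b -> limit1_in g (fun x => a <= x <= b) (g t) t.

Definition abs_cont_on (g : R -> R) (a b : R) : Prop :=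
  forall eps, 0 < eps -> exists delta, 0 < delta /\
    forall l : list (R * R),
      (forall p, In p l -> a <= fst p /\ fst p <= snd p /\ snd p <= b) ->
      (forall i j, (i < length l)%nat -> (j < length l)%nat -> i <> j ->
         snd (nth i l (0,0)) <= fst (nth j l (0,0)) \/
         snd (nth j l (0,0)) <= fst (nth i l (0,0))) ->
      fold_right (fun p s => (snd p - fst p) + s) 0 l < delta ->
      fold_right (fun p s => Rabs (g (snd p) - g (fst p)) + s) 0 l < eps.

Definition AC2_with (u u' : R -> R) (a b : R) : Prop :=
  deriv_on u u' a b /\ cont_on u' a b /\ abs_cont_on u' a b.

Definition conf_deriv (beta a : R) (h : R -> R) (t l : R) : Prop :=
  limit1_in (fun e => (h (t + e * Rpower (t - a) (1 - beta)) - h t) / e)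
            (fun e => e <> 0) l 0.

(* For 1 < alpha < 2: T^a_alpha g (t) = T^a_(alpha-1) g' (t) = l. *)
Definition conf_deriv2 (alpha a : R) (g' : R -> R) (t l : R) : Prop :=
  conf_deriv (alpha - 1) a g' t l.

Definition AC2_twice_with_T (alpha a b : R) (u : R -> R) (P : R -> R -> Prop) : Prop :=
  exists u' : R -> R, AC2_with u u' a b /\
    (forall t, a < t < b -> exists l, derivable_pt_lim u' t l) /\
    (forall t, a < t < b -> exists T, conf_deriv2 alpha a u' t T /\ P t T).

Definition lower_sol (alpha a b : R) (f : R -> R -> R) (s : R -> R) : Prop :=
  AC2_twice_with_T alpha a b s (fun t T => T + f t (s t) >= 0) /\ s a <= 0 /\ s b <= 0.

Definition upper_sol (alpha a b : R) (f : R -> R -> R) (s : R -> R) : Prop :=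
  AC2_twice_with_T alpha a b s (fun t T => T + f t (s t) <= 0) /\ s a >= 0 /\ s b >= 0.

Definition is_solution (alpha a b : R) (f : R -> R -> R) (u : R -> R) : Prop :=
  AC2_twice_with_T alpha a b u (fun t T => T + f t (u t) = 0) /\ u a = 0 /\ u b = 0.

Definition in_E (a b : R) (sl su : R -> R) (t x : R) : Prop :=
  a <= t <= b /\ sl t <= x <= su t.

Definition cont_on_E (f : R -> R -> R) (a b : R) (sl su : R -> R) : Prop :=
  forall t x, in_E a b sl su t x ->
    forall eps, 0 < eps -> exists delta, 0 < delta /\
      forall s y, in_E a b sl su s y -> Rabs (s - t) < delta -> Rabs (y - x) < delta ->
        Rabs (f s y - f t x) < eps.

(* Main.v *)
(** The nonlinearity is frozen outside the strip [sl <= x <= su] and completed by a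
    bounded term pulling towards the strip. With [W(t) = (t-a)^(alpha-1)/(alpha-1)],
    the modified equation is [u' = v], [dv = - F(t,u) dW] with [F] continuous and
    bounded and [W] continuous and monotone. Euler polygons for this system depend
    continuously on the initial slope, so the intermediate value theorem yields slopes
    for which the polygons vanish at [b]. The limit of the polygons along a free
    ultrafilter on [nat] is a solution: the polygons are equicontinuous, hence their
    increments near [t0] are governed by [F(t0,u(t0))]. No integral is needed, the
    equation for [dv] being read as a derivative of [v] with respect to [W]. Finally
    [u - sl] and [su - u] have no negative interior minimum, by the second derivative
    test, so [u] stays in the strip, where the modification is inactive. *)

Require Import Defs.
From Stdlib Require Import Reals Lra Lia List Classical ClassicalEpsilon.
From mathcomp Require filter.
Open Scope R_scope.

(** * Limits along a free ultrafilter *)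

Lemma Rabs_le_inv (x y : R) : Rabs x <= y -> - y <= x <= y.
Proof. unfold Rabs. destruct (Rcase_abs x); lra. Qed.

Record free_ultrafilter (U : (nat -> Prop) -> Prop) : Prop := {
  uf_mono : forall A B : nat -> Prop, (forall n, A n -> B n) -> U A -> U B;
  uf_and : forall A B : nat -> Prop, U A -> U B -> U (fun n => A n /\ B n);
  uf_ex : forall A : nat -> Prop, U A -> exists n, A n;
  uf_em : forall A : nat -> Prop, U A \/ U (fun n => ~ A n);
  uf_tail : forall N, U (fun n => (N <= n)%nat) }.

(** The sets containing a tail of [nat] form a proper filter, and a maximal proper filter above it
    is free. The dichotomy [uf_em] comes from maximality. *)
Lemma free_ultrafilter_exists : exists U, free_ultrafilter U.
Proof.
  set (E := fun A : nat -> Prop => exists N, forall n, (N <= n)%nat -> A n).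
  assert (HE : @filter.ProperFilter nat E).
  { constructor.
    - intros [N HN]. exact (HN N (le_n N)).
    - constructor.
      + exists 0%nat. intros n _. exact I.
      + intros A B [N HN] [N' HN']. exists (Nat.max N N'). intros n Hn.
        split; [apply HN | apply HN']; lia.
      + intros A B HAB [N HN]. exists N. intros n Hn. apply HAB, HN, Hn. }
  destruct (@filter.ultraFilterLemma nat E HE) as [U [[[H0 [HT HI HS]] Hmax] HEU]].
  assert (Hmono : forall A B : nat -> Prop, (forall n, A n -> B n) -> U A -> U B)
    by exact HS.
  assert (Hand : forall A B : nat -> Prop, U A -> U B -> U (fun n => A n /\ B n))
    by exact HI.
  exists U. constructor; trivial.
  - intros A HA. apply NNPP. intro Hn. apply H0.
    apply Hmono with A; trivial. intros n An. exfalso. apply Hn. exists n. exact An.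
  - intro A. destruct (classic (U (fun n => ~ A n))) as [Hn | Hn]; [now right | left].
    (* [G] is the filter generated by [U] and [A]. It is proper exactly because the complement of
       [A] is not in [U], so by maximality [G] equals [U], which puts [A] in [U]. *)
    set (G := fun B : nat -> Prop => U (fun n => A n -> B n)).
    assert (HG : @filter.ProperFilter nat G).
    { constructor.
      - intro HG. apply Hn. exact HG.
      - constructor.
        + apply Hmono with (2 := HT). intros n _ _. exact I.
        + intros B C HB HC.
          apply Hmono with (2 := Hand _ _ HB HC). intros n [H1 H2] An.
          split; [apply H1 | apply H2]; exact An.
        + intros B C HBC HB. apply Hmono with (2 := HB).
          intros n H1 An. apply HBC, H1, An. }
    rewrite <- (Hmax G HG).
    + apply Hmono with (2 := HT). intros n _ An. exact An.
    + intros B HB. apply Hmono with (2 := HB). intros n Bn _. exact Bn.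
  - intro N. apply HEU. exists N. trivial.
Qed.

Definition ulim (U : (nat -> Prop) -> Prop) (x : nat -> R) (l : R) : Prop :=
  forall eps, 0 < eps -> U (fun n => Rabs (x n - l) < eps).

Section UltraLimits.
Context {U : (nat -> Prop) -> Prop} (HU : free_ultrafilter U).

Lemma uf_all (A : nat -> Prop) : (forall n, A n) -> U A.
Proof.
  intro H. apply (uf_mono U HU) with (2 := uf_tail U HU 0). intros n _. apply H.
Qed.

(** The limit is the supremum of the [y] that lie below [x n] for [U]-almost all [n]. If an estimate
    fails to hold almost everywhere, [uf_em] makes its negation hold almost everywhere, which
    contradicts the supremum. *)
Lemma ulim_bounded (x : nat -> R) (m M : R) :
  (forall n, m <= x n <= M) -> exists l, ulim U x l /\ m <= l <= M.
Proof.
  intro Hx.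
  destruct (completeness (fun y => U (fun n => y <= x n))) as [l [Hub Hlub]].
  - exists M. intros y Hy. destruct (uf_ex U HU _ Hy) as [n Hn].
    destruct (Hx n). lra.
  - exists m. apply uf_all. intro n. apply Hx.
  - exists l. split.
    + intros eps Heps.
      assert (H1 : U (fun n => l - eps < x n)).
      { destruct (uf_em U HU (fun n => l - eps < x n)) as [H | H]; trivial.
        assert (l <= l - eps); [|lra]. apply Hlub. intros y Hy.
        destruct (uf_ex U HU _ (uf_and U HU _ _ H Hy)) as [n [H2 H3]]. lra. }
      assert (H2 : U (fun n => x n < l + eps)).
      { destruct (uf_em U HU (fun n => x n < l + eps)) as [H | H]; trivial.
        assert (l + eps <= l); [|lra]. apply Hub.
        apply (uf_mono U HU) with (2 := H). intros n Hn. lra. }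
      apply (uf_mono U HU) with (2 := uf_and U HU _ _ H1 H2).
      intros n [H3 H4]. apply Rabs_def1; lra.
    + split.
      * apply Hub, uf_all. intro n. apply Hx.
      * apply Hlub. intros y Hy. destruct (uf_ex U HU _ Hy) as [n Hn].
        destruct (Hx n). lra.
Qed.

Lemma ulim_continuous (g : R -> R) (x : nat -> R) (l : R) :
  continuity_pt g l -> ulim U x l -> ulim U (fun n => g (x n)) (g l).
Proof.
  intros Hg Hx eps Heps. destruct (Hg eps Heps) as [d [Hd H]].
  apply (uf_mono U HU) with (2 := Hx d Hd). intros n Hn.
  (* [continuity_pt] only tests points distinct from [l], so equality is a case of its own. *)
  destruct (Req_dec (x n) l) as [-> | Hne].
  - rewrite Rminus_diag, Rabs_R0. exact Heps.
  - apply (H (x n)). split; [split; [exact I | auto] | exact Hn].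
Qed.

Lemma ulim_plus (x y : nat -> R) (l k : R) :
  ulim U x l -> ulim U y k -> ulim U (fun n => x n + y n) (l + k).
Proof.
  intros Hx Hy eps Heps.
  assert (He : 0 < eps / 2) by lra.
  apply (uf_mono U HU) with (2 := uf_and U HU _ _ (Hx _ He) (Hy _ He)).
  intros n [H1 H2]. apply Rabs_def2 in H1. apply Rabs_def2 in H2.
  apply Rabs_def1; lra.
Qed.

Lemma ulim_scal (c : R) (x : nat -> R) (l : R) :
  ulim U x l -> ulim U (fun n => c * x n) (c * l).
Proof.
  apply (ulim_continuous (fun y => c * y)).
  apply derivable_continuous_pt. reg.
Qed.

Lemma ulim_minus (x y : nat -> R) (l k : R) :
  ulim U x l -> ulim U y k -> ulim U (fun n => x n - y n) (l - k).
Proof.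
  intros Hx Hy. replace (l - k) with (l + (-1) * k) by ring.
  intros eps Heps.
  apply (uf_mono U HU) with (2 := ulim_plus _ _ _ _ Hx (ulim_scal (-1) _ _ Hy) eps Heps).
  intros n Hn. now replace (x n - y n) with (x n + -1 * y n) by ring.
Qed.

Lemma ulim_abs (x : nat -> R) (l : R) :
  ulim U x l -> ulim U (fun n => Rabs (x n)) (Rabs l).
Proof. apply ulim_continuous, Rcontinuity_abs. Qed.

Lemma ulim_le (x y : nat -> R) (l k : R) :
  ulim U x l -> ulim U y k -> U (fun n => x n <= y n) -> l <= k.
Proof.
  intros Hx Hy Hle. apply Rnot_lt_le. intro Hlt.
  assert (He : 0 < (l - k) / 2) by lra.
  destruct (uf_ex U HU _ (uf_and U HU _ _ Hle (uf_and U HU _ _ (Hx _ He) (Hy _ He))))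
    as [n [H1 [H2 H3]]].
  apply Rabs_def2 in H2. apply Rabs_def2 in H3. lra.
Qed.

Lemma ulim_unique (x : nat -> R) (l k : R) : ulim U x l -> ulim U x k -> l = k.
Proof.
  intros Hl Hk. apply Rle_antisym; eapply ulim_le; eauto; apply uf_all; intro; apply Rle_refl.
Qed.

Lemma ulim_inv_nat (c : R) : 0 <= c -> ulim U (fun n => c / INR (S n)) 0.
Proof.
  intros Hc eps Heps.
  destruct (INR_unbounded (c / eps)) as [N HN].
  apply (uf_mono U HU) with (2 := uf_tail U HU N). intros n Hn.
  assert (0 < INR (S n)) by (apply lt_0_INR; lia).
  assert (INR N < INR (S n)) by (apply lt_INR; lia).
  rewrite Rminus_0_r, Rabs_pos_eq.
  - apply Rmult_lt_reg_r with (INR (S n)); trivial.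
    apply Rmult_lt_reg_r with (/ eps); [now apply Rinv_0_lt_compat|].
    replace (c / INR (S n) * INR (S n) * / eps) with (c / eps) by (field; lra).
    replace (eps * INR (S n) * / eps) with (INR (S n)) by (field; lra). lra.
  - apply Rmult_le_pos; trivial. left. now apply Rinv_0_lt_compat.
Qed.

End UltraLimits.

(** * Shooting with Euler polygons *)

(** A discrete mean value inequality, obtained by summing the errors [(g k - c) * (Z (S k) - Z k)].
    With [c = 0] it bounds increments; with [c] the value at a point and [e] small it prepares a
    derivative of the limit with respect to [Z]. *)
Lemma increment_bound (X Z g : nat -> R) (c e : R) (i j : nat) :
  (i <= j)%nat ->
  (forall k, (i <= k < j)%nat -> X (S k) = X k + g k * (Z (S k) - Z k)) ->
  (forall k, (i <= k < j)%nat -> Z k <= Z (S k)) ->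
  (forall k, (i <= k < j)%nat -> Rabs (g k - c) <= e) ->
  Rabs (X j - X i - c * (Z j - Z i)) <= e * (Z j - Z i).
Proof.
  induction 1 as [|j Hij IH]; intros HX HZ Hg.
  - rewrite !Rminus_diag, !Rmult_0_r, Rminus_diag, Rabs_R0. lra.
  - assert (IH' := IH (fun k Hk => HX k ltac:(lia)) (fun k Hk => HZ k ltac:(lia))
                      (fun k Hk => Hg k ltac:(lia))).
    rewrite (HX j ltac:(lia)).
    replace (X j + g j * (Z (S j) - Z j) - X i - c * (Z (S j) - Z i))
      with ((X j - X i - c * (Z j - Z i)) + (g j - c) * (Z (S j) - Z j)) by ring.
    eapply Rle_trans; [apply Rabs_triang|].
    rewrite Rabs_mult, (Rabs_pos_eq (Z (S j) - Z j)) by (pose proof (HZ j ltac:(lia)); lra).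
    assert (Rabs (g j - c) * (Z (S j) - Z j) <= e * (Z (S j) - Z j)).
    { apply Rmult_le_compat_r; [|apply Hg; lia]. pose proof (HZ j ltac:(lia)); lra. }
    lra.
Qed.

(** * Uniform grids on the interval *)

Definition grid (a b : R) (n k : nat) : R := a + INR k * ((b - a) / INR (S n)).

Section Grid.
Context (a b : R) (Hab : a < b).

Lemma grid_S n k : grid a b n (S k) = grid a b n k + (b - a) / INR (S n).
Proof. unfold grid. rewrite (S_INR k). ring. Qed.

Lemma grid_step_pos n : 0 < (b - a) / INR (S n).
Proof. apply Rdiv_lt_0_compat; [lra | apply lt_0_INR; lia]. Qed.

Lemma grid_0 n : grid a b n 0 = a.
Proof. unfold grid. simpl. ring. Qed.

Lemma grid_last n : grid a b n (S n) = b.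
Proof. unfold grid. field. apply not_0_INR. lia. Qed.

Lemma grid_le n i j : (i <= j)%nat -> grid a b n i <= grid a b n j.
Proof.
  intro H. apply Rplus_le_compat_l, Rmult_le_compat_r.
  - left. apply grid_step_pos.
  - now apply le_INR.
Qed.

Lemma grid_index n t :
  a <= t <= b ->
  exists k, (k <= S n)%nat /\ grid a b n k <= t < grid a b n k + (b - a) / INR (S n).
Proof.
  intro Ht.
  (* Induction on a node to the right of [t]. It is used with [m = S n]: the node after [b] is
     needed because [t = b] has index [S n]. *)
  assert (H : forall m, t < grid a b n (S m) ->
    exists k, (k <= m)%nat /\ grid a b n k <= t < grid a b n k + (b - a) / INR (S n)).
  { induction m as [|m IH]; intro Hm.
    - exists 0%nat. rewrite grid_S in Hm. rewrite grid_0 in *. split; [lia | lra].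
    - destruct (Rlt_le_dec t (grid a b n (S m))) as [Hlt | Hle].
      + destruct (IH Hlt) as [k [Hk Hk']]. exists k. split; [lia | exact Hk'].
      + exists (S m). rewrite (grid_S n (S m)) in Hm. split; [lia | lra]. }
  apply H. rewrite grid_S, grid_last. pose proof (grid_step_pos n). lra.
Qed.

End Grid.

Lemma continuity_ext (f g : R -> R) :
  (forall x, f x = g x) -> continuity f -> continuity g.
Proof.
  intros Hfg Hf x. apply (continuity_pt_locally_ext f g 1 x Rlt_0_1) with (2 := Hf x). intros y _. apply Hfg.
Qed.

(** The explicit Euler scheme for [u' = v], [dv = - F(t,u) dW], started at height 0 with slope [s];
    [T] and [W] list the nodes and the weights at the nodes. *)
Fixpoint euler (F : R -> R -> R) (W T : nat -> R) (s : R) (k : nat) : R * R :=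
  match k with
  | O => (0, s)
  | S k => let (x, v) := euler F W T s k in
           (x + v * (T (S k) - T k), v - F (T k) x * (W (S k) - W k))
  end.

(** A polygon is a finite composition of continuous maps, so continuous dependence on the slope asks
    for no Lipschitz condition on [F]. *)
Lemma euler_continuous F W T k :
  (forall t, continuity (F t)) ->
  continuity (fun s => fst (euler F W T s k)) /\
  continuity (fun s => snd (euler F W T s k)).
Proof.
  intro HF. induction k as [|k [IH1 IH2]].
  - split; simpl; [apply continuity_const; easy | apply derivable_continuous, derivable_id].
  - split.
    + apply (continuity_ext (fun s => fst (euler F W T s k)
        + snd (euler F W T s k) * (T (S k) - T k))).
      { intro s. simpl. now destruct (euler F W T s k). }
      apply continuity_plus; trivial.
      apply continuity_mult; trivial. apply continuity_const; easy.
    + apply (continuity_ext (fun s => snd (euler F W T s k)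
        - F (T k) (fst (euler F W T s k)) * (W (S k) - W k))).
      { intro s. simpl. now destruct (euler F W T s k). }
      apply continuity_minus; trivial.
      apply continuity_mult; [|apply continuity_const; easy].
      exact (continuity_comp (fun s => fst (euler F W T s k)) (F (T k)) IH1 (HF _)).
Qed.

(** The slope drifts from [s] by at most [B = M * (W b - W a)], so the endpoint differs from
    [s * (b - a)] by at most [B * (b - a)]. A zero endpoint is thus found with [s] between
    [-(B + 1)] and [B + 1], and the slopes are then at most [2 * B + 1] in absolute value, uniformly
    in [n] as the limit requires. *)
Lemma euler_shooting (F : R -> R -> R) (W : R -> R) (M a b : R) (n : nat) :
  a < b -> (forall t x, Rabs (F t x) <= M) -> (forall t, continuity (F t)) ->
  (forall s t, s <= t -> W s <= W t) ->
  exists x v : nat -> R, x 0%nat = 0 /\ x (S n) = 0 /\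
    (forall k, x (S k) = x k + v k * (grid a b n (S k) - grid a b n k)) /\
    (forall k, v (S k) = v k + - F (grid a b n k) (x k) *
                                 (W (grid a b n (S k)) - W (grid a b n k))) /\
    (forall k, (k <= S n)%nat -> Rabs (v k) <= 2 * (M * (W b - W a)) + 1).
Proof.
  intros Hab HM HF HW.
  set (T := grid a b n). set (Wk := fun k => W (T k)).
  set (x := fun s k => fst (euler F Wk T s k)).
  set (v := fun s k => snd (euler F Wk T s k)).
  set (B := M * (W b - W a)).
  assert (Hx : forall s k, x s (S k) = x s k + v s k * (T (S k) - T k)).
  { intros s k. unfold x, v. simpl. now destruct (euler F Wk T s k). }
  assert (Hv : forall s k, v s (S k) = v s k + - F (T k) (x s k) * (Wk (S k) - Wk k)).
  { intros s k. unfold x, v. simpl. destruct (euler F Wk T s k). simpl. ring. }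
  assert (HM0 : 0 <= M).
  { apply Rle_trans with (2 := HM 0 0). apply Rabs_pos. }
  assert (HTm : forall k, (k <= S n)%nat -> T k <= b).
  { intros k Hk. rewrite <- (grid_last a b n). now apply grid_le. }
  assert (Hvs : forall s k, (k <= S n)%nat -> Rabs (v s k - s) <= B).
  { intros s k Hk.
    assert (H := increment_bound (v s) Wk (fun k => - F (T k) (x s k)) 0 M 0 k
      ltac:(lia) (fun k _ => Hv s k)).
    replace (v s k - s) with (v s k - v s 0%nat - 0 * (Wk k - Wk 0%nat))
      by (unfold v at 2; simpl; ring).
    eapply Rle_trans; [apply H|].
    - intros j _. apply HW, grid_le; [exact Hab | lia].
    - intros j _. rewrite Rminus_0_r, Rabs_Ropp. apply HM.
    - apply Rmult_le_compat_l; trivial. unfold Wk, T. rewrite grid_0.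
      assert (W (grid a b n k) <= W b) by (apply HW, HTm, Hk). lra. }
  assert (Hxs : forall s, Rabs (x s (S n) - s * (b - a)) <= B * (b - a)).
  { intro s.
    assert (H := increment_bound (x s) T (v s) s B 0 (S n)
      ltac:(lia) (fun k _ => Hx s k)).
    unfold T in H. rewrite grid_0, grid_last in H.
    replace (x s 0%nat) with 0 in H by reflexivity. rewrite Rminus_0_r in H. apply H.
    - intros j _. apply grid_le; [exact Hab | lia].
    - intros j Hj. apply Hvs. lia. }
  assert (HB : 0 <= B).
  { apply Rmult_le_pos; trivial. pose proof (HW a b ltac:(lra)). lra. }
  (* At [s = B + 1] the endpoint is at least [b - a], and at [s = -(B + 1)] at most [-(b - a)]. *)
  destruct (IVT (fun s => x s (S n)) (- (B + 1)) (B + 1)) as [s [Hs Hs0]].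
  - apply euler_continuous, HF.
  - lra.
  - pose proof (Hxs (- (B + 1))) as H. apply Rabs_le_inv in H. nra.
  - pose proof (Hxs (B + 1)) as H. apply Rabs_le_inv in H. nra.
  - exists (x s), (v s). repeat split; trivial.
    intros k Hk. pose proof (Hvs s k Hk) as H. apply Rabs_le_inv in H.
    apply Rabs_le. fold B. lra.
Qed.

(** * Passage to the limit along the ultrafilter *)

Section Limit.
Context {U : (nat -> Prop) -> Prop} (HU : free_ultrafilter U).
Context (a b : R) (Hab : a < b) (idx : nat -> R -> nat).
Context (Hidx : forall n t, a <= t <= b -> (idx n t <= S n)%nat /\
  grid a b n (idx n t) <= t < grid a b n (idx n t) + (b - a) / INR (S n)).

Lemma ulim_grid_index t : a <= t <= b -> ulim U (fun n => grid a b n (idx n t)) t.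
Proof.
  intros Ht eps Heps.
  apply (uf_mono U HU) with (2 := ulim_inv_nat HU (b - a) ltac:(lra) eps Heps).
  intros n Hn. rewrite Rminus_0_r in Hn. apply Rabs_def2 in Hn.
  destruct (Hidx n t Ht) as [_ H]. apply Rabs_def1; lra.
Qed.

(* The hypothesis on [g] is only asked near [t0], so the conclusion with small [e]
   differentiates the limit [x] with respect to [Z] at [t0]. *)
Lemma ulim_increment (Z : R -> R) (X g : nat -> nat -> R) (x : R -> R) (t0 c e r : R) :
  continuity Z -> (forall s t, s <= t -> Z s <= Z t) ->
  (forall n k, X n (S k) = X n k + g n k * (Z (grid a b n (S k)) - Z (grid a b n k))) ->
  (forall t, a <= t <= b -> ulim U (fun n => X n (idx n t)) (x t)) ->
  a <= t0 <= b ->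
  U (fun n => forall k, (k <= S n)%nat -> Rabs (grid a b n k - t0) < r ->
                        Rabs (g n k - c) <= e) ->
  forall t, a <= t <= b -> Rabs (t - t0) < r ->
    Rabs (x t - x t0 - c * (Z t - Z t0)) <= e * Rabs (Z t - Z t0).
Proof.
  intros HZc HZ HX Hx Ht0 Hg t Ht Hr.
  assert (HZg : forall s, a <= s <= b ->
    ulim U (fun n => Z (grid a b n (idx n s))) (Z s)).
  { intros s Hs. apply (ulim_continuous HU); [apply HZc | now apply ulim_grid_index]. }
  refine (ulim_le HU _ _ _ _
    (ulim_abs HU _ _ (ulim_minus HU _ _ _ _ (ulim_minus HU _ _ _ _ (Hx t Ht) (Hx t0 Ht0))
       (ulim_scal HU c _ _ (ulim_minus HU _ _ _ _ (HZg t Ht) (HZg t0 Ht0)))))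
    (ulim_scal HU e _ _ (ulim_abs HU _ _ (ulim_minus HU _ _ _ _ (HZg t Ht) (HZg t0 Ht0)))) _).
  (* Once the mesh is below this spare distance, every node between the cells of [t] and [t0] stays
     within [r] of [t0], where the hypothesis on [g] applies. *)
  assert (He : 0 < r - Rabs (t - t0)) by lra.
  apply (uf_mono U HU) with
    (2 := uf_and U HU _ _ Hg (ulim_inv_nat HU (b - a) ltac:(lra) _ He)).
  intros n [Hn Hh]. rewrite Rminus_0_r in Hh. apply Rabs_def2 in Hh.
  (* Stated for two points so that it serves both orders of [t] and [t0]; the second order changes
     the sign of both increments. *)
  assert (Hmain : forall s1 s2, a <= s1 <= b -> a <= s2 <= b ->
    Rabs (s1 - t0) <= Rabs (t - t0) -> Rabs (s2 - t0) <= Rabs (t - t0) ->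
    (idx n s1 <= idx n s2)%nat ->
    Rabs (X n (idx n s2) - X n (idx n s1)
      - c * (Z (grid a b n (idx n s2)) - Z (grid a b n (idx n s1))))
    <= e * (Z (grid a b n (idx n s2)) - Z (grid a b n (idx n s1)))).
  { intros s1 s2 Hs1 Hs2 Hd1 Hd2 Hle.
    apply (increment_bound (X n) (fun k => Z (grid a b n k)) (g n)); trivial.
    - intros k _. apply HZ, grid_le; [exact Hab | lia].
    - intros k Hk. destruct (Hidx n s1 Hs1) as [_ H1]. destruct (Hidx n s2 Hs2) as [Hk2 H2].
      apply Hn; [lia|].
      assert (grid a b n (idx n s1) <= grid a b n k) by (apply grid_le; [exact Hab | lia]).
      assert (grid a b n k <= grid a b n (idx n s2)) by (apply grid_le; [exact Hab | lia]).
      apply Rabs_le_inv in Hd1. apply Rabs_le_inv in Hd2. apply Rabs_def1; lra. }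
  assert (H00 : Rabs (t0 - t0) <= Rabs (t - t0)).
  { rewrite Rminus_diag, Rabs_R0. apply Rabs_pos. }
  destruct (Nat.le_ge_cases (idx n t0) (idx n t)) as [Hle | Hle].
  - rewrite (Rabs_pos_eq (Z _ - Z _)).
    + apply Hmain; trivial. lra.
    + apply (grid_le a b Hab n) in Hle. apply HZ in Hle. lra.
  - rewrite <- (Rabs_Ropp (Z _ - Z _)), <- Rabs_Ropp, (Rabs_pos_eq (- (Z _ - Z _))).
    + assert (H := Hmain t t0 Ht Ht0 (Rle_refl _) H00 Hle).
      match type of H with Rabs ?p <= e * ?q =>
        match goal with |- Rabs ?p' <= e * ?q' =>
          replace p' with p by ring; replace q' with q by ring end end.
      exact H.
    + apply (grid_le a b Hab n) in Hle. apply HZ in Hle. lra.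
Qed.

End Limit.

(** The two derivatives are stated with the increments multiplied out, so that they make sense at
    the endpoints and where [W] has no derivative. The bound on the increments of [v] will give its
    continuity and absolute continuity. *)
Lemma stieltjes_bvp (F : R -> R -> R) (W : R -> R) (M a b : R) :
  a < b -> (forall t x, Rabs (F t x) <= M) ->
  (forall t x eps, 0 < eps -> exists d, 0 < d /\
     forall s y, Rabs (s - t) < d -> Rabs (y - x) < d -> Rabs (F s y - F t x) < eps) ->
  continuity W -> (forall s t, s <= t -> W s <= W t) ->
  exists u v : R -> R, u a = 0 /\ u b = 0 /\
    (forall t0 t, a <= t0 <= b -> a <= t <= b ->
       Rabs (v t - v t0) <= M * Rabs (W t - W t0)) /\
    (forall t0, a <= t0 <= b -> forall eps, 0 < eps -> exists r, 0 < r /\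
       forall t, a <= t <= b -> Rabs (t - t0) < r ->
         Rabs (u t - u t0 - v t0 * (t - t0)) <= eps * Rabs (t - t0)) /\
    (forall t0, a <= t0 <= b -> forall eps, 0 < eps -> exists r, 0 < r /\
       forall t, a <= t <= b -> Rabs (t - t0) < r ->
         Rabs (v t - v t0 - - F t0 (u t0) * (W t - W t0)) <= eps * Rabs (W t - W t0)).
Proof.
  intros Hab HM HF HWc HW.
  destruct free_ultrafilter_exists as [U HU].
  assert (HFx : forall t, continuity (F t)).
  { intros t x eps Heps. destruct (HF t x eps Heps) as [d [Hd H]].
    exists d. split; trivial. intros y [_ Hy]. apply H; trivial.
    rewrite Rminus_diag, Rabs_R0. exact Hd. }
  set (K := 2 * (M * (W b - W a)) + 1).
  destruct (choice (fun n (p : (nat -> R) * (nat -> R)) => fst p 0%nat = 0 /\ fst p (S n) = 0 /\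
    (forall k, fst p (S k) = fst p k + snd p k * (grid a b n (S k) - grid a b n k)) /\
    (forall k, snd p (S k) = snd p k + - F (grid a b n k) (fst p k) *
                                 (W (grid a b n (S k)) - W (grid a b n k))) /\
    (forall k, (k <= S n)%nat -> Rabs (snd p k) <= K))) as [P HP].
  { intro n. destruct (euler_shooting F W M a b n Hab HM HFx HW) as [x [v H]].
    exists (x, v). exact H. }
  destruct (choice (fun (q : nat * R) k => a <= snd q <= b -> (k <= S (fst q))%nat /\
    grid a b (fst q) k <= snd q < grid a b (fst q) k + (b - a) / INR (S (fst q))))
    as [idx' Hidx'].
  { intros [n t]. destruct (classic (a <= t <= b)) as [Ht | Ht].
    - destruct (grid_index a b Hab n t Ht) as [k Hk]. exists k. intros _. exact Hk.
    - exists 0%nat. intro H. contradiction. }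
  set (idx := fun n t => idx' (n, t)).
  assert (Hidx : forall n t, a <= t <= b -> (idx n t <= S n)%nat /\
    grid a b n (idx n t) <= t < grid a b n (idx n t) + (b - a) / INR (S n)).
  { intros n t. exact (Hidx' (n, t)). }
  clearbody idx. clear idx' Hidx'.
  set (X := fun n => fst (P n)). set (V := fun n => snd (P n)).
  assert (HX : forall n k, X n (S k) = X n k + V n k * (grid a b n (S k) - grid a b n k))
    by (intros n k; apply HP).
  assert (HV : forall n k, V n (S k) = V n k + - F (grid a b n k) (X n k) *
      (W (grid a b n (S k)) - W (grid a b n k))) by (intros n k; apply HP).
  assert (HVK : forall n k, (k <= S n)%nat -> Rabs (V n k) <= K)
    by (intros n k; apply HP).
  assert (HXK : forall n i j, (i <= j)%nat -> (j <= S n)%nat ->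
    Rabs (X n j - X n i) <= K * (grid a b n j - grid a b n i)).
  { intros n i j Hij Hj.
    replace (X n j - X n i) with (X n j - X n i - 0 * (grid a b n j - grid a b n i)) by ring.
    apply (increment_bound (X n) (grid a b n) (V n)); trivial.
    - intros k Hk. apply grid_le; [exact Hab | lia].
    - intros k Hk. rewrite Rminus_0_r. apply HVK. lia. }
  (* These bounds on the increments of [X] and [V] do not depend on [n]: they are the equicontinuity
     of the polygons and of their slopes. *)
  assert (HVM : forall n i j, (i <= j)%nat ->
    Rabs (V n j - V n i) <= M * (W (grid a b n j) - W (grid a b n i))).
  { intros n i j Hij.
    replace (V n j - V n i)
      with (V n j - V n i - 0 * (W (grid a b n j) - W (grid a b n i))) by ring.
    apply (increment_bound (V n) (fun k => W (grid a b n k))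
             (fun k => - F (grid a b n k) (X n k))); trivial.
    - intros k Hk. apply HW, grid_le; [exact Hab | lia].
    - intros k Hk. rewrite Rminus_0_r, Rabs_Ropp. apply HM. }
  assert (HK : 0 <= K).
  { apply Rle_trans with (2 := HVK 0%nat 0%nat ltac:(lia)). apply Rabs_pos. }
  assert (HM0 : 0 <= M).
  { apply Rle_trans with (2 := HM 0 0). apply Rabs_pos. }
  destruct (choice (fun t y => a <= t <= b -> ulim U (fun n => X n (idx n t)) y))
    as [u Hu].
  { intro t. destruct (classic (a <= t <= b)) as [Ht | Ht].
    - destruct (ulim_bounded HU (fun n => X n (idx n t)) (- (K * (b - a))) (K * (b - a)))
        as [l [Hl _]]; [|now exists l].
      intro n. destruct (Hidx n t Ht) as [H1 [H2 _]].
      assert (H := HXK n 0%nat (idx n t) ltac:(lia) H1).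
      replace (X n 0%nat) with 0 in H by (symmetry; apply HP).
      rewrite grid_0, Rminus_0_r in H. apply Rabs_le_inv in H.
      assert (K * (grid a b n (idx n t) - a) <= K * (b - a))
        by (apply Rmult_le_compat_l; lra).
      lra.
    - exists 0. intro H. contradiction. }
  destruct (choice (fun t y => a <= t <= b -> ulim U (fun n => V n (idx n t)) y))
    as [v Hv].
  { intro t. destruct (classic (a <= t <= b)) as [Ht | Ht].
    - destruct (ulim_bounded HU (fun n => V n (idx n t)) (- K) K)
        as [l [Hl _]]; [|now exists l].
      intro n. apply Rabs_le_inv, HVK, Hidx, Ht.
    - exists 0. intro H. contradiction. }
  exists u, v.
  split; [|split; [|split; [|split]]].
  - apply (ulim_unique HU _ _ _ (Hu a ltac:(lra))).
    intros eps Heps. apply (uf_all HU). intro n.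
    (* The node of index 1 already exceeds [a], so [a] has index 0 and the sequence is constantly
       0. *)
    replace (idx n a) with 0%nat.
    { replace (X n 0%nat) with 0 by (symmetry; apply HP).
      rewrite Rminus_diag, Rabs_R0. exact Heps. }
    destruct (Hidx n a ltac:(lra)) as [_ [H _]].
    destruct (idx n a) as [|k]; trivial. exfalso.
    apply (Rlt_irrefl a). apply Rlt_le_trans with (2 := H).
    apply Rlt_le_trans with (grid a b n 1).
    + rewrite grid_S, grid_0. pose proof (grid_step_pos a b Hab n). lra.
    + apply grid_le; [exact Hab | lia].
  - apply (ulim_unique HU _ _ _ (Hu b ltac:(lra))).
    intros eps Heps. apply (uf_all HU). intro n.
    (* An index below [S n] would put [b] strictly to the left of some node, and no node up to index
       [S n] exceeds [b]. The value at the last node is 0 by the shooting. *)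
    replace (idx n b) with (S n).
    { replace (X n (S n)) with 0 by (symmetry; apply HP).
      rewrite Rminus_diag, Rabs_R0. exact Heps. }
    destruct (Hidx n b ltac:(lra)) as [H1 [_ H]].
    apply Nat.le_antisymm; trivial. apply Nat.nlt_ge. intro Hlt.
    apply (Rlt_irrefl b). apply Rlt_le_trans with (1 := H).
    rewrite <- grid_S. apply Rle_trans with (grid a b n (S n)).
    + apply grid_le; [exact Hab | lia].
    + rewrite grid_last. lra.
  - intros t0 t Ht0 Ht.
    replace (v t - v t0) with (v t - v t0 - 0 * (W t - W t0)) by ring.
    apply (ulim_increment HU a b Hab idx Hidx W V (fun n k => - F (grid a b n k) (X n k))
      v t0 0 M (Rabs (t - t0) + 1)); trivial; [|lra].
    apply (uf_all HU). intros n k _ _. rewrite Rminus_0_r, Rabs_Ropp. apply HM.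
  - intros t0 Ht0 eps Heps.
    (* Nodes near [t0] have weights within [e] of each other, so the slopes there differ by at most
       [M * e]; the remaining [eps - M * e], which is positive, is spent on the convergence to
       [v t0]. *)
    set (e := eps / (2 * (M + 1))).
    assert (He : 0 < e) by (apply Rdiv_lt_0_compat; lra).
    assert (HMe : 2 * M * e <= eps).
    { replace eps with (2 * (M + 1) * e) by (unfold e; field; lra). lra. }
    destruct (HWc t0 (e / 2) ltac:(lra)) as [d [Hd HWd]].
    exists d. split; trivial.
    apply (ulim_increment HU a b Hab idx Hidx (fun t => t) X V); trivial.
    { apply derivable_continuous, derivable_id. }
    assert (HWt : ulim U (fun n => W (grid a b n (idx n t0))) (W t0)).
    { apply (ulim_continuous HU); [apply HWc | now apply (ulim_grid_index HU a b Hab idx)]. }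
    assert (HMe' : 0 < eps - M * e).
    { assert (eps = 2 * (M + 1) * e) by (unfold e; field; lra). nra. }
    apply (uf_mono U HU) with
      (2 := uf_and U HU _ _ (Hv t0 Ht0 _ HMe') (HWt (e / 2) ltac:(lra))).
    intros n [H1 H2] k Hk Hkd.
    assert (H3 : Rabs (W (grid a b n k) - W t0) < e / 2).
    { destruct (Req_dec (grid a b n k) t0) as [-> | Hne].
      - rewrite Rminus_diag, Rabs_R0. lra.
      - apply HWd. split; [split; [exact I | auto] | exact Hkd]. }
    assert (H4 : Rabs (V n k - V n (idx n t0)) <= M * e).
    { apply Rabs_def2 in H2. apply Rabs_def2 in H3.
      destruct (Nat.le_ge_cases (idx n t0) k) as [Hle | Hle].
      - eapply Rle_trans; [apply HVM, Hle|]. apply Rmult_le_compat_l; lra.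
      - rewrite Rabs_minus_sym.
        eapply Rle_trans; [apply HVM, Hle|]. apply Rmult_le_compat_l; lra. }
    apply Rabs_def2 in H1. apply Rabs_le_inv in H4. apply Rabs_le. lra.
  - intros t0 Ht0 eps Heps.
    destruct (HF t0 (u t0) eps Heps) as [d [Hd HFd]].
    (* Two nodes within [r] of [t0] are less than [2 * r] apart, so the heights there differ by at
       most [2 * K * r < d / 2]; the other [d / 2] is spent on the convergence to [u t0]. Also
       [r < d]. *)
    set (r := d / (4 * (K + 1))).
    assert (Hr : 0 < r) by (apply Rdiv_lt_0_compat; lra).
    assert (Hdr : d = 4 * (K + 1) * r) by (unfold r; field; lra).
    exists r. split; trivial.
    apply (ulim_increment HU a b Hab idx Hidx W V (fun n k => - F (grid a b n k) (X n k)));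
      trivial.
    apply (uf_mono U HU) with
      (2 := uf_and U HU _ _ (Hu t0 Ht0 (d / 2) ltac:(lra))
              (ulim_grid_index HU a b Hab idx Hidx t0 Ht0 r Hr)).
    intros n [H1 H2] k Hk Hkd.
    assert (H4 : Rabs (X n k - X n (idx n t0)) <= K * (2 * r)).
    { apply Rabs_def2 in H2. apply Rabs_def2 in Hkd.
      destruct (Nat.le_ge_cases (idx n t0) k) as [Hle | Hle].
      - eapply Rle_trans; [apply HXK; trivial|]. apply Rmult_le_compat_l; lra.
      - rewrite Rabs_minus_sym.
        eapply Rle_trans; [apply HXK; [trivial | now apply Hidx]|].
        apply Rmult_le_compat_l; lra. }
    replace (- F (grid a b n k) (X n k) - - F t0 (u t0))
      with (- (F (grid a b n k) (X n k) - F t0 (u t0))) by ring.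
    rewrite Rabs_Ropp. left. apply HFd.
    + nra.
    + apply Rabs_def2 in H1. apply Rabs_le_inv in H4. apply Rabs_def1; nra.
Qed.

(** * Absolute continuity *)

Definition nonoverlapping (p q : R * R) : Prop := snd p <= fst q \/ snd q <= fst p.

(** Trades the indexed form of disjointness in [abs_cont_on] for one that passes to tails and to
    filtered lists. *)
Lemma nonoverlapping_nth (l : list (R * R)) :
  (forall i j, (i < length l)%nat -> (j < length l)%nat -> i <> j ->
     nonoverlapping (nth i l (0, 0)) (nth j l (0, 0))) ->
  ForallOrdPairs nonoverlapping l.
Proof.
  induction l as [|p l IH]; intro H; constructor.
  - apply Forall_forall. intros q Hq. destruct (In_nth _ _ (0, 0) Hq) as [j [Hj <-]].
    apply (H 0%nat (S j)); simpl; lia.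
  - apply IH. intros i j Hi Hj Hij. apply (H (S i) (S j)); simpl; lia.
Qed.

Lemma ForallOrdPairs_filter {A : Type} (r : A -> A -> Prop) (h : A -> bool) (l : list A) :
  ForallOrdPairs r l -> ForallOrdPairs r (filter h l).
Proof.
  induction 1 as [|x l Hx Hl IH]; simpl; [constructor|].
  destruct (h x); trivial. constructor; trivial.
  rewrite Forall_forall in *. intros y Hy. apply Hx. now apply filter_In in Hy.
Qed.

Definition variation (g : R -> R) (l : list (R * R)) : R :=
  fold_right (fun p s => (g (snd p) - g (fst p)) + s) 0 l.

Lemma variation_filter g (h : R * R -> bool) l :
  variation g l = variation g (filter h l) + variation g (filter (fun p => negb (h p)) l).
Proof.
  induction l as [|p l IH]; simpl; [ring|].
  destruct (h p); simpl; rewrite IH; ring.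
Qed.

(** The list is not sorted. As in quicksort, the head interval [p] separates the others into those
    in [[A, fst p]] and those in [[snd p, B]], and the three bounds telescope. *)
Lemma variation_monotone (g : R -> R) :
  (forall s t, s <= t -> g s <= g t) ->
  forall (l : list (R * R)) (A B : R), A <= B ->
  (forall p, In p l -> A <= fst p /\ fst p <= snd p /\ snd p <= B) ->
  ForallOrdPairs nonoverlapping l -> variation g l <= g B - g A.
Proof.
  intro Hg.
  (* Filtered lists are not tails, hence the induction on a bound for the length. *)
  assert (H : forall n l A B, (length l <= n)%nat -> A <= B ->
    (forall p, In p l -> A <= fst p /\ fst p <= snd p /\ snd p <= B) ->
    ForallOrdPairs nonoverlapping l -> variation g l <= g B - g A).
  2: { intros l A B. apply (H (length l)). lia. }
  induction n as [|n IH]; intros [|p l] A B Hn HAB Hl Hno; simpl in Hn;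
    try (simpl; pose proof (Hg A B HAB); lra); [lia|].
  inversion_clear Hno as [|? ? Hp Hno']. rewrite Forall_forall in Hp.
  set (h := fun q : R * R => if Rle_dec (snd q) (fst p) then true else false).
  destruct (Hl p (or_introl eq_refl)) as [Hp1 [Hp2 Hp3]].
  assert (H1 : variation g (filter h l) <= g (fst p) - g A).
  { apply IH; trivial.
    - pose proof (filter_length_le h l). lia.
    - intros q Hq. apply filter_In in Hq. destruct Hq as [Hq Hh].
      destruct (Hl q (or_intror Hq)). unfold h in Hh.
      destruct (Rle_dec (snd q) (fst p)); [lra | discriminate].
    - now apply ForallOrdPairs_filter. }
  assert (H2 : variation g (filter (fun q => negb (h q)) l) <= g B - g (snd p)).
  { apply IH; trivial.
    - pose proof (filter_length_le (fun q => negb (h q)) l). lia.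
    - intros q Hq. apply filter_In in Hq. destruct Hq as [Hq Hh].
      destruct (Hl q (or_intror Hq)). unfold h in Hh.
      destruct (Rle_dec (snd q) (fst p)); [discriminate|].
      destruct (Hp q Hq); lra.
    - now apply ForallOrdPairs_filter. }
  simpl. fold (variation g l). rewrite (variation_filter g h l). lra.
Qed.

(** [W] may have infinite slope at [a]. Continuity at [a] provides [c] such that the whole variation
    of [W] on [[a, c]] is below [e]; beyond [c] the Lipschitz constant [L] converts small total
    length into small variation. *)
Lemma abs_cont_on_dominated (W v : R -> R) (M a b : R) :
  a < b -> 0 <= M -> continuity W -> (forall s t, s <= t -> W s <= W t) ->
  (forall c, a < c -> exists L, 0 <= L /\
     forall s t, c <= s -> s <= t -> W t - W s <= L * (t - s)) ->
  (forall s t, a <= s <= b -> a <= t <= b -> Rabs (v t - v s) <= M * Rabs (W t - W s)) ->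
  abs_cont_on v a b.
Proof.
  intros Hab HM HWc HW HL Hv eps Heps.
  set (e := eps / (2 * (M + 1))).
  assert (He : 0 < e) by (apply Rdiv_lt_0_compat; lra).
  assert (Heps' : eps = 2 * (M + 1) * e) by (unfold e; field; lra).
  destruct (HWc a e He) as [d0 [Hd0 Hd]]. simpl in Hd.
  set (c := a + Rmin (d0 / 2) (b - a)).
  assert (Hc : a < c <= b /\ c < a + d0).
  { unfold c, Rmin. destruct (Rle_dec (d0 / 2) (b - a)); lra. }
  assert (HWca : W c - W a < e).
  { assert (H : Rabs (W c - W a) < e).
    { apply Hd. split; [split; [exact I | lra]|]. unfold Rdist. apply Rabs_def1; lra. }
    apply Rabs_def2 in H. lra. }
  destruct (HL c ltac:(lra)) as [L [HL0 HLc]].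
  exists (e / (L + 1)). split; [apply Rdiv_lt_0_compat; lra|].
  intros l Hl Hno Hsum.
  (* [W] is Lipschitz beyond [c], and its variation before [c] is small. *)
  set (g := fun t => W (Rmin t c)).
  assert (Hg : variation g l <= W c - W a).
  { replace c with (Rmin b c) at 1 by (apply Rmin_right; lra).
    replace a with (Rmin a c) at 1 by (apply Rmin_left; lra).
    apply (variation_monotone g) with (A := a) (B := b); trivial; [|lra|].
    - intros s t Hst. apply HW. apply Rle_min_compat_r. exact Hst.
    - apply nonoverlapping_nth. exact Hno. }
  assert (H : fold_right (fun p s => Rabs (v (snd p) - v (fst p)) + s) 0 l <=
    M * (variation g l + L * fold_right (fun p s => (snd p - fst p) + s) 0 l)).
  { clear Hno Hsum Hg. induction l as [|[s t] l IH]; simpl; [lra|].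
    specialize (IH (fun p Hp => Hl p (or_intror Hp))). fold (variation g l).
    destruct (Hl (s, t) (or_introl eq_refl)) as [H1 [H2 H3]]. simpl in H1, H2, H3.
    assert (H4 := Hv s t ltac:(lra) ltac:(lra)).
    rewrite (Rabs_pos_eq (W t - W s)) in H4 by (pose proof (HW s t H2); lra).
    (* An interval containing [c] is cut there: [g] measures the part before [c], and [L] bounds the
       part after. *)
    assert (H5 : W t - W s <= (g t - g s) + L * (t - s)).
    { unfold g. destruct (Rle_lt_dec t c) as [Ht | Ht].
      - rewrite !Rmin_left by lra.
        assert (0 <= L * (t - s)) by (apply Rmult_le_pos; lra). lra.
      - rewrite (Rmin_right t) by lra. destruct (Rle_lt_dec s c) as [Hs | Hs].
        + rewrite Rmin_left by lra. pose proof (HLc c t ltac:(lra) ltac:(lra)).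
          assert (L * (t - c) <= L * (t - s)) by (apply Rmult_le_compat_l; lra). lra.
        + rewrite Rmin_right by lra. pose proof (HLc s t ltac:(lra) ltac:(lra)). lra. }
    assert (M * (W t - W s) <= M * ((g t - g s) + L * (t - s)))
      by (apply Rmult_le_compat_l; lra).
    lra. }
  set (D := fold_right (fun p s => (snd p - fst p) + s) 0 l) in *.
  assert (HD : L * D <= e).
  { assert (L * D <= L * (e / (L + 1))) by (apply Rmult_le_compat_l; lra).
    assert (L * (e / (L + 1)) = e - e / (L + 1)) by (field; lra).
    assert (0 < e / (L + 1)) by (apply Rdiv_lt_0_compat; lra). lra. }
  assert (M * (variation g l + L * D) <= M * (2 * e)) by (apply Rmult_le_compat_l; lra).
  lra.
Qed.

(** * The singular weight *)

(* Antiderivative of the singular weight (t - a)^(beta - 1); the case distinction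
   is needed because [Rpower 0 beta = 1]. *)
Definition weight (a beta t : R) : R :=
  if Rle_dec t a then 0 else Rpower (t - a) beta / beta.

Section Weight.
Context (a beta : R) (Hbeta : 0 < beta < 1).

Lemma weight_left t : t <= a -> weight a beta t = 0.
Proof. intro H. unfold weight. destruct (Rle_dec t a); [easy | lra]. Qed.

Lemma weight_right t : a < t -> weight a beta t = Rpower (t - a) beta / beta.
Proof. intro H. unfold weight. destruct (Rle_dec t a); [lra | easy]. Qed.

Lemma weight_nonneg t : 0 <= weight a beta t.
Proof.
  destruct (Rle_lt_dec t a) as [H | H].
  - rewrite weight_left by trivial. lra.
  - rewrite weight_right by trivial. left. apply Rdiv_lt_0_compat; [apply exp_pos | lra].
Qed.

Lemma weight_monotone s t : s <= t -> weight a beta s <= weight a beta t.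
Proof.
  intro Hst. destruct (Rle_lt_dec s a) as [H | H].
  - rewrite (weight_left s H). apply weight_nonneg.
  - rewrite !weight_right by lra. apply Rmult_le_compat_r.
    + left. apply Rinv_0_lt_compat. lra.
    + apply Rle_Rpower_l; lra.
Qed.

Lemma weight_derivable t :
  a < t -> derivable_pt_lim (weight a beta) t (Rpower (t - a) (beta - 1)).
Proof.
  intro Ht.
  assert (H : derivable_pt_lim (fun s => Rpower (s - a) beta / beta) t
                (Rpower (t - a) (beta - 1))).
  { assert (H1 : derivable_pt_lim (fun s => s - a) t (1 - 0)).
    { apply derivable_pt_lim_minus; [apply derivable_pt_lim_id | apply derivable_pt_lim_const]. }
    assert (H2 := derivable_pt_lim_comp _ (fun x => Rpower x beta) _ _ _ H1
      (derivable_pt_lim_power (t - a) beta ltac:(lra))).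
    assert (H3 := derivable_pt_lim_scal _ (/ beta) _ _ H2).
    replace (Rpower (t - a) (beta - 1))
      with (/ beta * (beta * Rpower (t - a) (beta - 1) * (1 - 0))) by (field; lra).
    intros eps Heps. destruct (H3 eps Heps) as [d Hd]. exists d. intros h Hh0 Hh.
    specialize (Hd h Hh0 Hh). unfold mult_real_fct, comp in Hd.
    unfold Rdiv at 2 3. rewrite !(Rmult_comm (Rpower _ _) (/ beta)). exact Hd. }
  intros eps Heps. destruct (H eps Heps) as [d Hd].
  assert (Hp : 0 < Rmin d (t - a)) by (apply Rmin_pos; [apply cond_pos | lra]).
  exists (mkposreal _ Hp). simpl. intros h Hh0 Hh.
  assert (Hh1 := Rlt_le_trans _ _ _ Hh (Rmin_l _ _)).
  assert (Hh2 := Rlt_le_trans _ _ _ Hh (Rmin_r _ _)). apply Rabs_def2 in Hh2.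
  rewrite !weight_right by lra. apply Hd; trivial.
Qed.

Lemma weight_continuous : continuity (weight a beta).
Proof.
  intro t. destruct (Rlt_le_dec a t) as [Ht | Ht].
  { apply derivable_continuous_pt. eexists. apply weight_derivable, Ht. }
  intros eps Heps.
  (* This radius [d] solves [Rpower d beta / beta = eps]. *)
  assert (Hd : 0 < Rpower (eps * beta) (/ beta)) by apply exp_pos.
  exists (Rpower (eps * beta) (/ beta)). split; trivial.
  intros s [_ Hs]. simpl in *. unfold Rdist in *. rewrite (weight_left t Ht), Rminus_0_r.
  rewrite Rabs_pos_eq by apply weight_nonneg.
  destruct (Rle_lt_dec s a) as [Hsa | Hsa]; [now rewrite weight_left|].
  rewrite weight_right by trivial. apply Rabs_def2 in Hs.
  apply Rmult_lt_reg_r with beta; [lra|].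
  replace (Rpower (s - a) beta / beta * beta) with (Rpower (s - a) beta) by (field; lra).
  replace (eps * beta) with (Rpower (Rpower (eps * beta) (/ beta)) beta).
  - apply Rlt_Rpower_l; lra.
  - rewrite Rpower_mult, Rinv_l, Rpower_1; trivial; [|lra]. apply Rmult_lt_0_compat; lra.
Qed.

(** As [beta < 1], the derivative [Rpower (x - a) (beta - 1)] decreases in [x], so its value at [c]
    is a Lipschitz constant beyond [c]. *)
Lemma weight_Lipschitz c : a < c -> exists L, 0 <= L /\
  forall s t, c <= s -> s <= t -> weight a beta t - weight a beta s <= L * (t - s).
Proof.
  intro Hc. exists (Rpower (c - a) (beta - 1)).
  split; [left; apply exp_pos|]. intros s t Hs [Hst | ->]; [|lra].
  destruct (MVT_cor2 (weight a beta) (fun x => Rpower (x - a) (beta - 1)) s t Hst) as [x [-> Hx]].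
  { intros x Hx. apply weight_derivable. lra. }
  apply Rmult_le_compat_r; [lra|]. unfold Rpower.
  assert (ln (c - a) < ln (x - a)) by (apply ln_increasing; lra).
  left. apply exp_increasing. nra.
Qed.

End Weight.

Lemma Rabs_div (x y : R) : Rabs (x / y) = Rabs x / Rabs y.
Proof. unfold Rdiv. now rewrite Rabs_mult, Rabs_inv. Qed.

(** The chain rule for a derivative with respect to [W]: with [q] the difference quotient of [W],
    the error splits into the increment of [v - c W] divided by [h], and [c * (q - w)]. Each part
    gets half of [eps]. *)
Lemma derivable_pt_lim_wrt (v W : R -> R) (a b t0 c w : R) :
  a < t0 < b -> derivable_pt_lim W t0 w ->
  (forall eps, 0 < eps -> exists r, 0 < r /\
     forall t, a <= t <= b -> Rabs (t - t0) < r ->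
       Rabs (v t - v t0 - c * (W t - W t0)) <= eps * Rabs (W t - W t0)) ->
  derivable_pt_lim v t0 (c * w).
Proof.
  intros Ht0 HW Hv eps Heps.
  pose proof (Rabs_pos c) as Hc. pose proof (Rabs_pos w) as Hw.
  set (e1 := eps / (2 * (Rabs w + 1))).
  assert (He1 : 0 < e1) by (apply Rdiv_lt_0_compat; lra).
  assert (Heps1 : eps / 2 = (Rabs w + 1) * e1) by (unfold e1; field; lra).
  set (e2 := eps / (2 * (Rabs c + 1))).
  assert (He2 : 0 < e2) by (apply Rdiv_lt_0_compat; lra).
  assert (Heps2 : eps / 2 = (Rabs c + 1) * e2) by (unfold e2; field; lra).
  destruct (Hv e1 He1) as [r [Hr Hvr]].
  (* The 1 bounds [Rabs q] by [Rabs w + 1] in the first part; [e2] makes the second part small. *)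
  destruct (HW (Rmin 1 e2) ltac:(apply Rmin_pos; lra)) as [d Hd].
  assert (Hp : 0 < Rmin (Rmin r d) (Rmin (t0 - a) (b - t0))).
  { repeat apply Rmin_pos; try lra. apply cond_pos. }
  exists (mkposreal _ Hp). simpl. intros h Hh0 Hh.
  assert (Hhr : Rabs h < r).
  { eapply Rlt_le_trans; [exact Hh|]. eapply Rle_trans; apply Rmin_l. }
  assert (Hhd : Rabs h < d).
  { eapply Rlt_le_trans; [exact Hh|]. eapply Rle_trans; [apply Rmin_l | apply Rmin_r]. }
  assert (Hha : Rabs h < t0 - a).
  { eapply Rlt_le_trans; [exact Hh|]. eapply Rle_trans; [apply Rmin_r | apply Rmin_l]. }
  assert (Hhb : Rabs h < b - t0).
  { eapply Rlt_le_trans; [exact Hh|]. eapply Rle_trans; apply Rmin_r. }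
  apply Rabs_def2 in Hha. apply Rabs_def2 in Hhb.
  specialize (Hd h Hh0 Hhd).
  specialize (Hvr (t0 + h) ltac:(lra)).
  replace (t0 + h - t0) with h in Hvr by ring. specialize (Hvr Hhr).
  set (q := (W (t0 + h) - W t0) / h) in *.
  replace (W (t0 + h) - W t0) with (q * h) in Hvr by (unfold q; field; trivial).
  replace ((v (t0 + h) - v t0) / h - c * w)
    with ((v (t0 + h) - v t0 - c * (q * h)) / h + c * (q - w)) by (field; trivial).
  eapply Rle_lt_trans; [apply Rabs_triang|].
  rewrite Rabs_div, Rabs_mult.
  assert (Hh1 : 0 < Rabs h) by now apply Rabs_pos_lt.
  assert (H1 : Rabs (v (t0 + h) - v t0 - c * (q * h)) / Rabs h <= e1 * Rabs q).
  { apply Rmult_le_reg_r with (Rabs h); trivial.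
    replace (Rabs (v (t0 + h) - v t0 - c * (q * h)) / Rabs h * Rabs h)
      with (Rabs (v (t0 + h) - v t0 - c * (q * h))) by (field; lra).
    rewrite Rabs_mult in Hvr. lra. }
  assert (Hq1 := Rlt_le_trans _ _ _ Hd (Rmin_l _ _)).
  assert (Hq2 := Rlt_le_trans _ _ _ Hd (Rmin_r _ _)).
  assert (H2 : Rabs q <= Rabs w + 1).
  { replace q with (w + (q - w)) by ring. eapply Rle_trans; [apply Rabs_triang|]. lra. }
  assert (H3 : e1 * Rabs q <= e1 * (Rabs w + 1)) by (apply Rmult_le_compat_l; lra).
  assert (H4 : Rabs c * Rabs (q - w) <= Rabs c * e2) by (apply Rmult_le_compat_l; lra).
  lra.
Qed.

(** * Derivatives *)

(** The conformable quotient is the ordinary one for the increment [e * P] with [P] positive,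
    multiplied by [P]. *)
Lemma conf_deriv_derivable (beta a t l : R) (h : R -> R) :
  derivable_pt_lim h t l -> conf_deriv beta a h t (l * Rpower (t - a) (1 - beta)).
Proof.
  intros Hh eps Heps. unfold Rdist. simpl.
  set (P := Rpower (t - a) (1 - beta)). assert (HP : 0 < P) by apply exp_pos.
  destruct (Hh (eps / P) ltac:(now apply Rdiv_lt_0_compat)) as [d Hd].
  exists (d / P). split; [apply Rdiv_lt_0_compat; [apply cond_pos | trivial]|].
  intros e [He0 He]. unfold Rdist in *. rewrite Rminus_0_r in He.
  assert (HeP : Rabs (e * P) < d).
  { rewrite Rabs_mult, (Rabs_pos_eq P) by lra.
    apply (Rmult_lt_compat_r P) in He; trivial.
    replace (d / P * P) with (pos d) in He by (field; lra). exact He. }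
  specialize (Hd (e * P) ltac:(apply Rmult_integral_contrapositive; lra) HeP).
  replace ((h (t + e * P) - h t) / e - l * P)
    with (((h (t + e * P) - h t) / (e * P) - l) * P) by (field; lra).
  rewrite Rabs_mult, (Rabs_pos_eq P) by lra.
  apply (Rmult_lt_compat_r P) in Hd; trivial.
  replace (eps / P * P) with eps in Hd by (field; lra). exact Hd.
Qed.

Lemma conf_deriv_unique (beta a t T T' : R) (h : R -> R) :
  conf_deriv beta a h t T -> conf_deriv beta a h t T' -> T = T'.
Proof.
  (* Uniqueness of limits needs 0 to be adherent to the nonzero reals; [eps / 2] is a witness. *)
  apply single_limit. intros eps Heps. exists (eps / 2). unfold Rdist.
  split; [lra|]. rewrite Rminus_0_r, Rabs_pos_eq; lra.
Qed.

Lemma deriv_on_interior (u u' : R -> R) (a b t : R) :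
  deriv_on u u' a b -> a < t < b -> derivable_pt_lim u t (u' t).
Proof.
  intros Hu Ht eps Heps. destruct (Hu t ltac:(lra) eps Heps) as [d0 [Hd0 Hd]].
  assert (Hp : 0 < Rmin d0 (Rmin (t - a) (b - t))) by (repeat apply Rmin_pos; lra).
  exists (mkposreal _ Hp). simpl. intros h Hh0 Hh.
  assert (Hh1 := Rlt_le_trans _ _ _ Hh (Rmin_l _ _)).
  assert (Hh2 := Rlt_le_trans _ _ _ Hh (Rle_trans _ _ _ (Rmin_r _ _) (Rmin_l _ _))).
  assert (Hh3 := Rlt_le_trans _ _ _ Hh (Rle_trans _ _ _ (Rmin_r _ _) (Rmin_r _ _))).
  apply Rabs_def2 in Hh2. apply Rabs_def2 in Hh3.
  specialize (Hd (t + h)). simpl in Hd. unfold Rdist in Hd.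
  replace (t + h - t) with h in Hd by ring. apply Hd. repeat split; trivial; lra.
Qed.

Lemma deriv_on_minus (u u' w w' : R -> R) (a b : R) :
  deriv_on u u' a b -> deriv_on w w' a b ->
  deriv_on (fun t => u t - w t) (fun t => u' t - w' t) a b.
Proof.
  intros Hu Hw t Ht eps Heps.
  destruct (limit_minus _ _ _ _ _ _ (Hu t Ht) (Hw t Ht) eps Heps) as [d [Hd H]].
  exists d. split; trivial. intros x Hx. specialize (H x Hx). simpl in *.
  replace ((u x - w x - (u t - w t)) / (x - t))
    with ((u x - u t) / (x - t) - (w x - w t) / (x - t)) by (field; lra).
  exact H.
Qed.

Lemma deriv_on_cont_on (u u' : R -> R) (a b : R) : deriv_on u u' a b -> cont_on u a b.
Proof.
  intros Hu t Ht eps Heps. destruct (Hu t Ht 1 Rlt_0_1) as [d0 [Hd0 Hd]].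
  pose proof (Rabs_pos (u' t)) as Hk.
  set (e := eps / (Rabs (u' t) + 1)).
  assert (He : 0 < e) by (apply Rdiv_lt_0_compat; lra).
  exists (Rmin d0 e). split; [now apply Rmin_pos|].
  simpl. unfold Rdist. simpl in Hd. unfold Rdist in Hd. intros x [Hx Hxt].
  destruct (Req_dec x t) as [-> | Hne]; [now rewrite Rminus_diag, Rabs_R0|].
  assert (Hx1 := Rlt_le_trans _ _ _ Hxt (Rmin_l _ _)).
  assert (Hx2 := Rlt_le_trans _ _ _ Hxt (Rmin_r _ _)).
  specialize (Hd x (conj (conj Hx Hne) Hx1)).
  set (q := (u x - u t) / (x - t)) in *.
  replace (u x - u t) with (q * (x - t)) by (unfold q; field; lra).
  assert (Hq : Rabs q <= Rabs (u' t) + 1).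
  { replace q with (u' t + (q - u' t)) by ring. eapply Rle_trans; [apply Rabs_triang|]. lra. }
  rewrite Rabs_mult.
  apply Rle_lt_trans with ((Rabs (u' t) + 1) * Rabs (x - t)).
  - apply Rmult_le_compat_r; [apply Rabs_pos | exact Hq].
  - replace eps with ((Rabs (u' t) + 1) * e) by (unfold e; field; lra).
    apply Rmult_lt_compat_l; lra.
Qed.

(** * Truncation and comparison *)

Definition clamp (l h x : R) : R := Rmax l (Rmin h x).

Lemma clamp_bounds l h x : l <= h -> l <= clamp l h x <= h.
Proof. unfold clamp, Rmax, Rmin. repeat destruct Rle_dec; lra. Qed.

Lemma clamp_id l h x : l <= x <= h -> clamp l h x = x.
Proof. unfold clamp, Rmax, Rmin. repeat destruct Rle_dec; lra. Qed.

(** The bounds vary along with the point because the strip moves with [t]. *)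
Lemma clamp_Lipschitz l h x l' h' x' d :
  Rabs (l' - l) < d -> Rabs (h' - h) < d -> Rabs (x' - x) < d ->
  Rabs (clamp l' h' x' - clamp l h x) < d.
Proof.
  intros H1 H2 H3. apply Rabs_def2 in H1. apply Rabs_def2 in H2. apply Rabs_def2 in H3.
  apply Rabs_def1; unfold clamp, Rmax, Rmin; repeat destruct Rle_dec; lra.
Qed.

Lemma clamp_Lipschitz_const l h x x' d :
  Rabs (x' - x) < d -> Rabs (clamp l h x' - clamp l h x) < d.
Proof.
  intro H. assert (0 < d) by (apply Rle_lt_trans with (2 := H); apply Rabs_pos).
  apply clamp_Lipschitz; trivial; now rewrite Rminus_diag, Rabs_R0.
Qed.

(** Extends a function continuous relative to [[a, b]] to the whole line, which makes the extreme
    value theorems and [ulim_continuous] applicable. *)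
Lemma cont_on_clamp (g : R -> R) (a b : R) :
  a <= b -> cont_on g a b -> continuity (fun t => g (clamp a b t)).
Proof.
  intros Hab Hg t eps Heps.
  destruct (Hg (clamp a b t) (clamp_bounds a b t Hab) eps Heps) as [d [Hd H]].
  exists d. split; trivial. intros s [_ Hs]. apply H. split.
  - now apply clamp_bounds.
  - now apply clamp_Lipschitz_const.
Qed.

(** A negative minimum would be interior, with [d' t0 = 0] and a negative second derivative. Then
    [d'] is negative just to the right of [t0], and by the mean value theorem [d] falls below its
    minimum. *)
Lemma second_derivative_principle (d d' : R -> R) (a b : R) :
  a < b -> deriv_on d d' a b -> 0 <= d a -> 0 <= d b ->
  (forall t, a < t < b -> d t < 0 -> exists l, l < 0 /\ derivable_pt_lim d' t l) ->
  forall t, a <= t <= b -> 0 <= d t.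
Proof.
  intros Hab Hd Hda Hdb Hneg.
  destruct (continuity_ab_min (fun t => d (clamp a b t)) a b) as [t0 [Hmin Ht0]].
  { lra. }
  { intros t _. apply cont_on_clamp; [lra|]. now apply deriv_on_cont_on with d'. }
  assert (Hmin' : forall t, a <= t <= b -> d t0 <= d t).
  { intros t Ht. specialize (Hmin t Ht). simpl in Hmin. now rewrite !clamp_id in Hmin. }
  destruct (Rle_lt_dec 0 (d t0)) as [Hpos | Hlt].
  { intros t Ht. pose proof (Hmin' t Ht). lra. }
  exfalso.
  assert (Hta : t0 <> a) by (intros ->; lra).
  assert (Htb : t0 <> b) by (intros ->; lra).
  assert (Ht : a < t0 < b) by lra.
  assert (Hd0 : d' t0 = 0).
  { assert (H := deriv_on_interior _ _ _ _ _ Hd Ht).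
    rewrite <- (derive_pt_eq_0 d t0 _ (exist _ _ H) H).
    apply deriv_minimum with a b; try lra. intros x Hx1 Hx2. apply Hmin'. lra. }
  destruct (Hneg t0 Ht Hlt) as [l [Hl Hdl]].
  (* With tolerance [- l] the quotients of [d'] at [t0] stay negative. *)
  destruct (Hdl (- l) ltac:(lra)) as [r Hr]. pose proof (cond_pos r) as Hr0.
  set (h := Rmin (r / 2) ((b - t0) / 2)).
  assert (Hh : 0 < h < r /\ t0 + h < b).
  { unfold h, Rmin. destruct Rle_dec; lra. }
  destruct (MVT_cor2 d d' t0 (t0 + h) ltac:(lra)) as [c [Hc1 Hc2]].
  { intros c Hc. apply deriv_on_interior with a b; trivial. lra. }
  pose proof (Hmin' (t0 + h) ltac:(lra)).
  assert (Hr1 : Rabs (c - t0) < r) by (apply Rabs_def1; lra).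
  specialize (Hr (c - t0) ltac:(lra) Hr1).
  replace (t0 + (c - t0)) with c in Hr by ring. rewrite Hd0, Rminus_0_r in Hr.
  apply Rabs_def2 in Hr. destruct Hr as [Hr _].
  assert (Hdc : d' c < 0).
  { replace (d' c) with (d' c / (c - t0) * (c - t0)) by (field; lra). nra. }
  nra.
Qed.

(** * Boundedness on the strip *)

Lemma cont_on_bounded (g : R -> R) (a b : R) :
  a <= b -> cont_on g a b -> exists M, forall t, a <= t <= b -> - M <= g t <= M.
Proof.
  intros Hab Hg. pose proof (cont_on_clamp g a b Hab Hg) as Hc.
  destruct (continuity_ab_maj _ a b Hab (fun t _ => Hc t)) as [s [Hs _]].
  destruct (continuity_ab_min _ a b Hab (fun t _ => Hc t)) as [m [Hm _]].
  exists (Rabs (g (clamp a b s)) + Rabs (g (clamp a b m))). intros t Ht.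
  specialize (Hs t Ht). specialize (Hm t Ht). simpl in Hs, Hm.
  rewrite (clamp_id a b t Ht) in Hs, Hm.
  unfold Rabs. repeat destruct Rcase_abs; lra.
Qed.

(** Compactness of the strip through the ultrafilter: points where [Rabs (f t x)] exceeds [n] have a
    limit, which lies in the strip because [sl] and [su] are continuous, and continuity of [f] there
    bounds [f] at nearby points of the strip. *)
Lemma cont_on_E_bounded (f : R -> R -> R) (a b : R) (sl su : R -> R) :
  a <= b -> cont_on sl a b -> cont_on su a b -> cont_on_E f a b sl su ->
  exists M, forall t x, in_E a b sl su t x -> Rabs (f t x) <= M.
Proof.
  intros Hab Hsl Hsu Hf. apply NNPP. intro Hunb.
  assert (H : forall n : nat, exists p : R * R,
    in_E a b sl su (fst p) (snd p) /\ INR n < Rabs (f (fst p) (snd p))).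
  { intro n. apply NNPP. intro Hn. apply Hunb. exists (INR n). intros t x Htx.
    apply Rnot_lt_le. intro Hlt. apply Hn. exists (t, x). now split. }
  destruct (choice _ H) as [p Hp]. clear H Hunb.
  destruct free_ultrafilter_exists as [U HU].
  destruct (cont_on_bounded sl a b Hab Hsl) as [M1 HM1].
  destruct (cont_on_bounded su a b Hab Hsu) as [M2 HM2].
  destruct (ulim_bounded HU (fun n => fst (p n)) a b) as [t [Ht Hta]].
  { intro n. apply Hp. }
  destruct (ulim_bounded HU (fun n => snd (p n)) (- M1) M2) as [x [Hx _]].
  { intro n. destruct (Hp n) as [[H1 H2] _].
    pose proof (HM1 _ H1). pose proof (HM2 _ H1). lra. }
  assert (HE : in_E a b sl su t x).
  { split; trivial. rewrite <- (clamp_id a b t Hta). split.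
    - apply (ulim_le HU _ _ _ _
        (ulim_continuous HU _ _ _ (cont_on_clamp sl a b Hab Hsl t) Ht) Hx).
      apply (uf_all HU). intro n. destruct (Hp n) as [[H1 H2] _].
      rewrite clamp_id; lra.
    - apply (ulim_le HU _ _ _ _ Hx
        (ulim_continuous HU _ _ _ (cont_on_clamp su a b Hab Hsu t) Ht)).
      apply (uf_all HU). intro n. destruct (Hp n) as [[H1 H2] _].
      rewrite clamp_id; lra. }
  destruct (Hf t x HE 1 Rlt_0_1) as [d [Hd Hfd]].
  destruct (INR_unbounded (Rabs (f t x) + 1)) as [N HN].
  destruct (uf_ex U HU _ (uf_and U HU _ _ (uf_tail U HU N)
              (uf_and U HU _ _ (Ht d Hd) (Hx d Hd)))) as [n [Hn [H1 H2]]].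
  destruct (Hp n) as [H3 H4]. specialize (Hfd _ _ H3 H1 H2).
  apply le_INR in Hn. pose proof (Rabs_triang_inv (f (fst (p n)) (snd (p n))) (f t x)). lra.
Qed.

(* [f] frozen outside the strip, plus a bounded term pulling back into it. *)
Definition truncation (f : R -> R -> R) (a b : R) (sl su : R -> R) (t x : R) : R :=
  let s := clamp a b t in
  let y := clamp (sl s) (su s) x in
  f s y + clamp (-1) 1 (y - x).

Section Truncation.
Context (f : R -> R -> R) (a b : R) (sl su : R -> R).
Context (Hab : a <= b) (Hle : forall t, a <= t <= b -> sl t <= su t).

Lemma truncation_in_E t x :
  in_E a b sl su (clamp a b t) (clamp (sl (clamp a b t)) (su (clamp a b t)) x).
Proof.
  assert (H := clamp_bounds a b t Hab). split; [exact H|]. apply clamp_bounds, Hle, H.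
Qed.

Lemma truncation_inside t x :
  in_E a b sl su t x -> truncation f a b sl su t x = f t x.
Proof.
  intros [Ht Hx]. unfold truncation. rewrite (clamp_id a b t Ht), (clamp_id _ _ x Hx).
  rewrite Rminus_diag, clamp_id; lra.
Qed.

(** The pulling term is strictly positive below the strip. This strictness lets the comparison work
    with the weak inequality that defines a lower solution. *)
Lemma truncation_below t x :
  a <= t <= b -> x < sl t -> f t (sl t) < truncation f a b sl su t x.
Proof.
  intros Ht Hx. unfold truncation. rewrite (clamp_id a b t Ht).
  replace (clamp (sl t) (su t) x) with (sl t).
  - assert (0 < clamp (-1) 1 (sl t - x)); [|lra].
    unfold clamp, Rmax, Rmin. repeat destruct Rle_dec; lra.
  - pose proof (Hle t Ht). unfold clamp, Rmax, Rmin. repeat destruct Rle_dec; lra.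
Qed.

Lemma truncation_above t x :
  a <= t <= b -> su t < x -> truncation f a b sl su t x < f t (su t).
Proof.
  intros Ht Hx. unfold truncation. rewrite (clamp_id a b t Ht).
  replace (clamp (sl t) (su t) x) with (su t).
  - assert (clamp (-1) 1 (su t - x) < 0); [|lra].
    unfold clamp, Rmax, Rmin. repeat destruct Rle_dec; lra.
  - pose proof (Hle t Ht). unfold clamp, Rmax, Rmin. repeat destruct Rle_dec; lra.
Qed.

Lemma truncation_bounded M :
  (forall t x, in_E a b sl su t x -> Rabs (f t x) <= M) ->
  forall t x, Rabs (truncation f a b sl su t x) <= M + 1.
Proof.
  intros HM t x. unfold truncation. eapply Rle_trans; [apply Rabs_triang|].
  apply Rplus_le_compat; [apply HM, truncation_in_E|].
  apply Rabs_le, clamp_bounds. lra.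
Qed.

Lemma truncation_continuous :
  cont_on sl a b -> cont_on su a b -> cont_on_E f a b sl su ->
  forall t x eps, 0 < eps -> exists d, 0 < d /\ forall s y,
    Rabs (s - t) < d -> Rabs (y - x) < d ->
    Rabs (truncation f a b sl su s y - truncation f a b sl su t x) < eps.
Proof.
  intros Hsl Hsu Hf t x eps Heps.
  destruct (Hf _ _ (truncation_in_E t x) (eps / 2) ltac:(lra)) as [d1 [Hd1 Hfd]].
  (* [d1] serves the continuity of [f]; [eps / 4] for the clamped point and for the point itself
     keeps the change of the pulling term below [eps / 2]. *)
  set (d2 := Rmin d1 (eps / 4)).
  assert (Hd2 : 0 < d2) by (apply Rmin_pos; lra).
  assert (Hd21 : d2 <= d1) by apply Rmin_l.
  assert (Hd2e : d2 <= eps / 4) by apply Rmin_r.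
  destruct (Hsl _ (clamp_bounds a b t Hab) d2 Hd2) as [d3 [Hd3 Hsld]].
  destruct (Hsu _ (clamp_bounds a b t Hab) d2 Hd2) as [d4 [Hd4 Hsud]].
  exists (Rmin d2 (Rmin d3 d4)). split; [repeat apply Rmin_pos; lra|].
  intros s y Hs Hy.
  assert (Hs2 := Rlt_le_trans _ _ _ Hs (Rmin_l _ _)).
  assert (Hs3 := Rlt_le_trans _ _ _ Hs (Rle_trans _ _ _ (Rmin_r _ _) (Rmin_l _ _))).
  assert (Hs4 := Rlt_le_trans _ _ _ Hs (Rle_trans _ _ _ (Rmin_r _ _) (Rmin_r _ _))).
  assert (Hy2 := Rlt_le_trans _ _ _ Hy (Rmin_l _ _)).
  assert (Hsl' : Rabs (sl (clamp a b s) - sl (clamp a b t)) < d2).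
  { apply Hsld. split; [now apply clamp_bounds | now apply clamp_Lipschitz_const]. }
  assert (Hsu' : Rabs (su (clamp a b s) - su (clamp a b t)) < d2).
  { apply Hsud. split; [now apply clamp_bounds | now apply clamp_Lipschitz_const]. }
  assert (Hc := clamp_Lipschitz _ _ _ _ _ _ d2 Hsl' Hsu' Hy2).
  assert (Hf' := Hfd _ _ (truncation_in_E s y)
    ltac:(apply clamp_Lipschitz_const; lra) ltac:(lra)).
  unfold truncation.
  set (ys := clamp (sl (clamp a b s)) (su (clamp a b s)) y) in *.
  set (yt := clamp (sl (clamp a b t)) (su (clamp a b t)) x) in *.
  assert (Hc2 : Rabs (clamp (-1) 1 (ys - y) - clamp (-1) 1 (yt - x)) < eps / 2).
  { apply clamp_Lipschitz_const. apply Rabs_def2 in Hc. apply Rabs_def2 in Hy2.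
    apply Rabs_def1; lra. }
  apply Rabs_def2 in Hf'. apply Rabs_def2 in Hc2. apply Rabs_def1; lra.
Qed.

End Truncation.

(** * Existence of a solution between the lower and the upper one *)

Theorem theorem1 (alpha a b : R) (f : R -> R -> R) (sl su : R -> R) :
  1 < alpha < 2 -> a < b ->
  lower_sol alpha a b f sl -> upper_sol alpha a b f su ->
  (forall t, a <= t <= b -> sl t <= su t) ->
  cont_on_E f a b sl su ->
  exists u : R -> R, is_solution alpha a b f u /\
    (forall t, a <= t <= b -> sl t <= u t <= su t).
Proof.
  intros Halpha Hab [[sl' [[Dsl _] [D2sl Tsl]]] [Hsla Hslb]]
    [[su' [[Dsu _] [D2su Tsu]]] [Hsua Hsub]] Hle Hf.
  assert (Hab' : a <= b) by lra.
  assert (Csl := deriv_on_cont_on _ _ _ _ Dsl).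
  assert (Csu := deriv_on_cont_on _ _ _ _ Dsu).
  destruct (cont_on_E_bounded f a b sl su Hab' Csl Csu Hf) as [M HM].
  set (F := truncation f a b sl su).
  set (beta := alpha - 1). assert (Hbeta : 0 < beta < 1) by (unfold beta; lra).
  set (W := weight a beta).
  assert (HWc : continuity W) by now apply weight_continuous.
  assert (HW : forall s t, s <= t -> W s <= W t) by now apply weight_monotone.
  assert (HFM : forall t x, Rabs (F t x) <= M + 1) by now apply truncation_bounded.
  assert (HM0 : 0 <= M + 1).
  { apply Rle_trans with (2 := HFM 0 0). apply Rabs_pos. }
  destruct (stieltjes_bvp F W (M + 1) a b Hab HFM
    (truncation_continuous f a b sl su Hab' Hle Csl Csu Hf) HWc HW)
    as [u [v [Hua [Hub [HvW [Hu Hv]]]]]].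
  assert (Du : deriv_on u v a b).
  { intros t Ht eps Heps. destruct (Hu t Ht (eps / 2) ltac:(lra)) as [r [Hr H]].
    exists r. split; trivial. intros x [[Hx Hne] Hxt]. simpl in *. unfold Rdist in *.
    specialize (H x Hx Hxt).
    replace ((u x - u t) / (x - t) - v t) with ((u x - u t - v t * (x - t)) / (x - t))
      by (field; lra).
    rewrite Rabs_div.
    assert (0 < Rabs (x - t)) by (apply Rabs_pos_lt; lra).
    apply Rmult_lt_reg_r with (Rabs (x - t)); trivial.
    unfold Rdiv. rewrite Rmult_assoc, Rinv_l, Rmult_1_r by lra.
    assert (0 < eps * Rabs (x - t)) by now apply Rmult_lt_0_compat. lra. }
  assert (Cv : cont_on v a b).
  { intros t Ht eps Heps.
    destruct (HWc t (eps / (M + 2)) ltac:(apply Rdiv_lt_0_compat; lra)) as [d [Hd H]].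
    exists d. split; trivial. intros x [Hx Hxt]. simpl in *. unfold Rdist in *.
    eapply Rle_lt_trans; [apply HvW; trivial|].
    assert (HWx : Rabs (W x - W t) < eps / (M + 2)).
    { destruct (Req_dec x t) as [-> | Hne].
      - rewrite Rminus_diag, Rabs_R0. apply Rdiv_lt_0_compat; lra.
      - apply H. split; [split; [exact I | auto] | exact Hxt]. }
    apply Rle_lt_trans with ((M + 1) * (eps / (M + 2))).
    - apply Rmult_le_compat_l; lra.
    - assert (0 < eps / (M + 2)) by (apply Rdiv_lt_0_compat; lra).
      replace eps with ((M + 2) * (eps / (M + 2))) at 2 by (field; lra). nra. }
  assert (ACv : abs_cont_on v a b).
  { apply (abs_cont_on_dominated W v (M + 1)); trivial. now apply weight_Lipschitz. }
  (* [Q] is the derivative of [W] to the right of [a], and [P] is the factor in the conformable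
     derivative; they are reciprocal on the interval. *)
  set (Q := fun t => Rpower (t - a) (beta - 1)).
  set (P := fun t => Rpower (t - a) (1 - beta)).
  assert (HQ : forall t, 0 < Q t) by (intro t; apply exp_pos).
  assert (HPQ : forall t, a < t < b -> P t * Q t = 1).
  { intros t Ht. unfold P, Q. rewrite <- Rpower_plus.
    replace (1 - beta + (beta - 1)) with 0 by ring. apply Rpower_O. lra. }
  assert (D2u : forall t, a < t < b -> derivable_pt_lim v t (- F t (u t) * Q t)).
  { intros t Ht. apply (derivable_pt_lim_wrt v W a b); trivial.
    - apply weight_derivable; trivial. lra.
    - apply Hv. lra. }
  (* The value [T] in the definition of a lower or upper solution is tied by uniqueness to the
     ordinary second derivative [l]. *)
  assert (Hsol : forall t s' T l, a < t < b -> derivable_pt_lim s' t l ->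
    conf_deriv2 alpha a s' t T -> l = T * Q t).
  { intros t s' T l Ht Hl HT.
    rewrite (conf_deriv_unique _ _ _ _ _ _ HT (conf_deriv_derivable beta a t l s' Hl)).
    fold (P t). rewrite Rmult_assoc, HPQ by trivial. ring. }
  assert (Hlow : forall t, a <= t <= b -> 0 <= u t - sl t).
  { apply second_derivative_principle with (fun t => v t - sl' t); trivial; try lra.
    - now apply deriv_on_minus.
    - intros t Ht Hneg. destruct (D2sl t Ht) as [l Hl]. destruct (Tsl t Ht) as [T [HT Hin]].
      exists (- F t (u t) * Q t - l). split.
      (* The second derivative of [u - sl] is [-(F t (u t) + T) * Q t], and below [sl] one has
         [F t (u t) > f t (sl t) >= - T]. *)
      + rewrite (Hsol t sl' T l Ht Hl HT).
        assert (H := truncation_below f a b sl su Hle t (u t) ltac:(lra) ltac:(lra)).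
        fold F in H. pose proof (HQ t). nra.
      + apply derivable_pt_lim_minus; [now apply D2u | trivial]. }
  assert (Hupp : forall t, a <= t <= b -> 0 <= su t - u t).
  { apply second_derivative_principle with (fun t => su' t - v t); trivial; try lra.
    - now apply deriv_on_minus.
    - intros t Ht Hneg. destruct (D2su t Ht) as [l Hl]. destruct (Tsu t Ht) as [T [HT Hin]].
      exists (l - - F t (u t) * Q t). split.
      + rewrite (Hsol t su' T l Ht Hl HT).
        assert (H := truncation_above f a b sl su Hle t (u t) ltac:(lra) ltac:(lra)).
        fold F in H. pose proof (HQ t). nra.
      + apply derivable_pt_lim_minus; [trivial | now apply D2u]. }
  assert (Hbetween : forall t, a <= t <= b -> sl t <= u t <= su t).
  { intros t Ht. pose proof (Hlow t Ht). pose proof (Hupp t Ht). lra. }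
  exists u. split; [|exact Hbetween]. split; [|now split].
  exists v. split; [|split].
  - split; [exact Du | split; [exact Cv | exact ACv]].
  - intros t Ht. eexists. now apply D2u.
  (* Since [P * Q = 1], this value is [- F t (u t)], and inside the strip [F] agrees with [f]. *)
  - intros t Ht. exists (- F t (u t) * Q t * P t). split.
    + exact (conf_deriv_derivable beta a t _ v (D2u t Ht)).
    + assert (HF : F t (u t) = f t (u t)).
      { apply truncation_inside. split; [lra | apply Hbetween; lra]. }
      rewrite HF. replace (- f t (u t) * Q t * P t) with (- f t (u t) * (P t * Q t)) by ring.
      rewrite HPQ by trivial. ring.
Qed.
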